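(* Let $X$ be a Banach space with $\dim X\ge 2$. Then $$C_{L}(X)\le\frac{1}{2}G_{L}(X).$$
   Context: For a Banach space $X$ with $\dim X\ge 2$, define $$C_{L}(X)=\sup\{\|x+y\|\cdot\|2x-y\|: x,y\in X,\ \|x\|=\|y\|=\|x-y\|=1\},$$ $$G_L(X)=\sup\{\|x+y\|^{2}+\|2x-y\|^{2}: x,y\in X,\ \|x\|=\|y\|=\|x-y\|=1\}.$$ *)

(* Defs.v *)
From HB Require Import structures.
From mathcomp Require Import all_boot all_order all_algebra.
From mathcomp Require Import all_classical all_reals all_analysis.
Set Implicit Arguments.
Unset Strict Implicit.
Unset Printing Implicit Defensive.
Import Order.TTheory GRing.Theory Num.Theory.
Import numFieldNormedType.Exports.
Local Open Scope classical_set_scope.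
Local Open Scope ring_scope.

Definition lin_indep (R : realType) (V : lmodType R) (n : nat)
    (v : 'I_n -> V) : Prop :=
  forall a : 'I_n -> R, \sum_(i < n) a i *: v i = 0 -> forall i, a i = 0.

(* The library's dimension is restricted to finite-dimensional spaces
   (vectType); here V may be infinite-dimensional. *)
Definition dim_ge (R : realType) (V : lmodType R) (n : nat) : Prop :=
  exists v : 'I_n -> V, lin_indep v.

(* [sup] is real-valued and returns 0 on sets that are empty or unbounded above.
   Neither case occurs below when dim X >= 2: the admissible pairs exist by
   connectedness of the unit sphere, and `|x + y| <= 2, `|2 x - y| <= 3. *)
Definition C_L (R : realType) (X : completeNormedModType R) : R :=
  sup [set r | exists x y : X, [/\ `|x| = 1, `|y| = 1, `|x - y| = 1 &
    r = `|x + y| * `|2 *: x - y|]].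

Definition G_L (R : realType) (X : completeNormedModType R) : R :=
  sup [set r | exists x y : X, [/\ `|x| = 1, `|y| = 1, `|x - y| = 1 &
    r = `|x + y| ^+ 2 + `|2 *: x - y| ^+ 2]].

(* Main.v *)
Require Import Defs.
From HB Require Import structures.
From mathcomp Require Import all_boot all_order all_algebra.
From mathcomp Require Import all_classical all_reals all_analysis.
From mathcomp Require Import lra.
Import Order.TTheory GRing.Theory Num.Theory.
Import numFieldNormedType.Exports.
Local Open Scope classical_set_scope.
Local Open Scope ring_scope.

(** For each admissible pair [x], [y], the inequality [a * b <= (a ^+ 2 + b ^+ 2) / 2],
    an instance of AM-GM, applied to [a = `|x + y|] and [b = `|2 *: x - y|], bounds
    the product defining [C_L X] by half of the sum defining [G_L X]
    ([mulr_le_half_sum_sqr]). It remains to pass to suprema. As [sup] is a real number,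
    a value of the sum is below [G_L X] only once these values are known to be bounded
    above; the triangle inequality provides this ([sqr_sum_le_G_L]). *)

Lemma mulr_le_half_sum_sqr {R : realFieldType} (a b : R) :
  a * b <= 1 / 2 * (a ^+ 2 + b ^+ 2).
Proof. by have := sqr_ge0 (a - b); rewrite sqrrB; lra. Qed.

(** On unit vectors the triangle inequality gives [`|x + y| <= 2] and
    [`|2 *: x - y| <= 3], so that [2 ^+ 2 + 3 ^+ 2] bounds all the values whose
    supremum is [G_L X]. *)
Lemma sqr_sum_le_G_L {R : realType} {X : completeNormedModType R} (x y : X) :
  `|x| = 1 -> `|y| = 1 -> `|x - y| = 1 ->
  `|x + y| ^+ 2 + `|2 *: x - y| ^+ 2 <= G_L X.
Proof.
move=> x1 y1 xy1; apply: ub_le_sup; last by exists x, y.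
exists (2 ^+ 2 + 3 ^+ 2) => _ [u [v [u1 v1 _ ->]]].
have uv2 : `|u + v| <= 2 by have := ler_normD u v; rewrite u1 v1; lra.
have uv3 : `|2 *: u - v| <= 3.
  by have := ler_normB (2 *: u) v; rewrite normrZ u1 v1 ger0_norm //; lra.
by apply: lerD; rewrite lerXn2r // nnegrE.
Qed.

Theorem proposition4p5 (R : realType) (X : completeNormedModType R)
  (hdim : dim_ge X 2) : C_L X <= 1 / 2 * G_L X.
Proof.
have [[x [y [x1 y1 xy1]]]|no_pair] :=
    pselect (exists x y : X, [/\ `|x| = 1, `|y| = 1 & `|x - y| = 1]).
  apply: ge_sup; first by exists (`|x + y| * `|2 *: x - y|), x, y.
  move=> _ [u [v [u1 v1 uv1 ->]]].
  apply: le_trans (mulr_le_half_sum_sqr _ _) _.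
  by rewrite ler_pM2l //; exact: sqr_sum_le_G_L.
(* Without admissible pairs both suprema are over the empty set, where [sup] is 0 by
   convention. *)
have no_value (f : X -> X -> R) : [set r | exists x y : X,
    [/\ `|x| = 1, `|y| = 1, `|x - y| = 1 & r = f x y]] = set0.
  rewrite -subset0 => r [x [y [x1 y1 xy1 _]]].
  by apply: no_pair; exists x, y.
by rewrite /C_L /G_L (no_value (fun x y => `|x + y| * `|2 *: x - y|))
  (no_value (fun x y => `|x + y| ^+ 2 + `|2 *: x - y| ^+ 2)) sup0 mulr0.
Qed.
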